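(* Let $G$ be a $(v,k,\lambda)_0$ relative skew Hadamard difference set group with difference set $D$ and subgroup $H$, and let $h=|H|$ (so $|G|=h^2$). Thinking of $D$ as an $h^2\times h^2$ matrix via the regular representation, let $$\mathcal H(D)=2D-J_{h^2}.$$ Then $\mathcal H(D)$ is a Hadamard matrix and its minimal polynomial is $(x+h)(x^2+h^2)$.
   Context: A $(v,k,\lambda)$ difference set in a finite group $G$ with $|G|=v$ is a non-empty subset $D\subset G$ with $|D|=k$ such that every $1\neq g\in G$ occurs exactly $\lambda$ times in the multiset $\{xy^{-1}:x,y\in D\}$. For $X\subseteq G$ write $X^{-1}=\{x^{-1}:x\in X\}$. A finite group $G$ is a $(v,k,\lambda)_0$ relative skew Hadamard difference set group with difference set $D$ and subgroup $H$ if $D\subset G$ is a $(v,k,\lambda)$ difference set, $1\ne H\le G$, $D\cap D^{-1}=\emptyset$ and $G\setminus(D\cup D^{-1})=H$. In such a group $|G|=|H|^2$. $D$ is identified with the group-algebra element $\sum_{d\in D}d$. $J_r$ is the $r\times r$ all-ones matrix. An $n\times n$ matrix $M$ is a Hadamard matrix if its entries are $\pm1$ and $MM^T=nI_n$. *)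

(* Defs.v *)
From mathcomp Require Import all_boot all_order all_algebra all_fingroup.
From mathcomp Require Import all_solvable all_field all_character.

Set Implicit Arguments.
Unset Strict Implicit.
Unset Printing Implicit Defensive.

Import GRing.Theory Num.Theory.
Local Open Scope ring_scope.

Definition difference_set (gT : finGroupType) (G : {group gT}) (v k lam : nat)
    (D : {set gT}) : Prop :=
  [/\ D != set0, D \subset G, #|G| = v, #|D| = k &
      forall g : gT, g \in G -> g != 1%g ->
        #|[set p in setX D D | (p.1 * p.2^-1)%g == g]| = lam].

Definition rel_skew_hadamard_ds_group (gT : finGroupType) (G : {group gT})
    (v k lam : nat) (D : {set gT}) (H : {group gT}) : Prop :=
  [/\ difference_set G v k lam D,
      H \subset G,
      H :!=: 1%g,
      D :&: D^-1%g = set0 &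
      G :\: (D :|: D^-1%g) = H].

Definition hadamard_mx (R : pzRingType) (n : nat) (M : 'M[R]_n) : Prop :=
  (forall i j, M i j = 1 \/ M i j = -1) /\ M *m M^T = n%:R%:M.

(* [gset_mx F G D] is the image of the group-algebra element \sum_(d in D) d
   under the regular representation; rows and columns are indexed by the
   elements of G through [enum_val]. *)
Definition hadamard_of (F : fieldType) (gT : finGroupType) (G : {group gT})
    (D : {set gT}) : 'M[F]_#|G| :=
  2%:R *: gset_mx F G D - const_mx 1.

(* [mxminpoly] is only defined for matrices whose size is syntactically a
   successor, hence the cast along #|G| = #|G|.-1.+1. *)
Definition group_minpoly (F : fieldType) (gT : finGroupType) (G : {group gT})
    (M : 'M[F]_#|G|) : {poly F} :=
  let e := esym (prednK (cardG_gt0 G)) in mxminpoly (castmx (e, e) M).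

(* Main.v *)
Require Import Defs.
From mathcomp Require Import all_boot all_order all_algebra all_fingroup.
From mathcomp Require Import all_solvable all_field all_character.
From mathcomp Require Import zify ring.

(** Write [J] for the all-ones matrix, [K] for the matrix of [H], and
    [M = 2 D - J].  Three relations carry the proof.

    - [|G| = h ^ 2] ([rel_skew_card]).  Counting [D x D] by quotients gives
      [k ^ 2 = k + lam (v - 1)], and [v = 2 k + h] because [G] is the disjoint
      union of [D], [D^-1] and [H].  Eliminating [k] shows that [v - 1] divides
      [h ^ 2 - 1]; as [h] divides [v] by Lagrange and [h < v], this leaves only
      [v = h ^ 2].  The order of the difference set is then
      [k - lam = h ^ 2 / 4].

    - [M M^T = h ^ 2 I] ([rel_skew_hadamard]): expanding the product with
      [D D^T = (k - lam) I + lam J] leaves [4 (k - lam) I], the coefficient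
      of [J] being [v - 4 (k - lam) = 0].

    - [M + M^T = - 2 K], which is the partition of [G] again, and
      [K ^ 2 = h K].

    From the last two items alone, [M K = - h K] ([skew_mul_proj]).  Hence
    [M ^ 2 + h ^ 2 I = - 2 M K = 2 h K] is killed by [M + h I], and the cubic
    annihilates [M].  It is minimal because [I], [M] and [K] are linearly
    independent: this is visible on the row of the identity element, at the
    columns of an element of [D], of a nontrivial element of [H], and of the
    identity. *)

Set Implicit Arguments.
Unset Strict Implicit.
Unset Printing Implicit Defensive.

Import GRing.Theory Num.Theory.
Local Open Scope ring_scope.

(** * Difference sets *)

Section DifferenceSet.

Variables (gT : finGroupType) (G : {group gT}) (v k lam : nat) (D : {set gT}).
Hypothesis ds : difference_set G v k lam D.

(** The group ring identity [D D^-1 = k + lam (G - 1)], read through an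
    arbitrary additive image [f] of the group elements: with [f = 1] it counts
    pairs, with [f] the regular representation it evaluates [D D^T]. *)
Lemma difference_set_sum (V : nmodType) (f : gT -> V) :
  \sum_(x in D) \sum_(y in D) f (x * y^-1)%g
    = f 1%g *+ k + (\sum_(g in G | g != 1%g) f g) *+ lam.
Proof.
case: ds => _ sDG _ kE lamE; rewrite pair_big /=.
have mulVG (p : gT * gT) :
    (p.1 \in D) && (p.2 \in D) -> (p.1 * p.2^-1)%g \in G.
  by case/andP=> /(subsetP sDG) ? /(subsetP sDG) ?; rewrite groupM ?groupV.
rewrite (partition_big (fun p : gT * gT => p.1 * p.2^-1)%g (mem G)) //=.
have fiber g : g \in G ->
    \sum_(p : gT * gT | (p.1 \in D) && (p.2 \in D) && ((p.1 * p.2^-1)%g == g))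
       f (p.1 * p.2^-1)%g
    = f g *+ #|[set p in setX D D | (p.1 * p.2^-1)%g == g]|.
  move=> gG; rewrite -sumr_const; apply: eq_big => [[x y]|p].
    by rewrite !inE.
  by case/andP=> _ /eqP->.
rewrite (eq_bigr _ fiber) (bigD1 1%g) //=; congr (_ *+ _ + _).
  (* The quotient is trivial exactly on the diagonal of [D x D]. *)
  have diag_inj : injective (fun x : gT => (x, x)) by move=> x y [].
  rewrite -kE -(card_imset (mem D) diag_inj); apply: eq_card => -[x y].
  rewrite [LHS]inE in_setX -eq_mulgV1 /=.
  apply/idP/imsetP => [/andP[/andP[xD _] /eqP <-]|[z zD [-> ->]]].
    by exists x.
  by rewrite zD /=.
by rewrite -sumrMnl; apply: eq_bigr => g /andP[gG g1]; rewrite lamE.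
Qed.

Lemma difference_set_count : (k * k = k + lam * #|G|.-1)%N.
Proof.
have sum1E : \sum_(g in G | g != 1%g) (1 : int) = #|G|.-1%:R.
  rewrite sumr_const (cardD1 1%g G) group1 /=; congr (_ *+ _).
  by apply: eq_card => g; rewrite !inE andbC.
have := difference_set_sum (fun=> 1 : int); rewrite sum1E !sumr_const.
case: ds => _ _ _ -> _.
by rewrite -!mulrnA -mulrnDr mulnC => /eqP; rewrite eqr_nat mulnC => /eqP.
Qed.

End DifferenceSet.

(** * The order of the group *)

Section RelativeSkew.

Variables (gT : finGroupType) (G : {group gT}) (v k lam : nat).
Variables (D : {set gT}) (H : {group gT}).
Hypothesis ds : rel_skew_hadamard_ds_group G v k lam D H.

Lemma rel_skew_partition (g : gT) :
  g \in G -> ((g \in D) + (g^-1%g \in D) + (g \in H) = 1)%N.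
Proof.
case: ds => _ _ _ disj defH gG; rewrite -defH !inE gG andbT.
have := in_set0 g; rewrite -disj !inE.
by case: (g \in D); case: (g^-1%g \in D).
Qed.

Lemma rel_skew_card_sum : #|G| = (2 * k + #|H|)%N.
Proof.
case: ds => -[_ sDG _ kE _] sHG _ disj defH.
rewrite -[LHS](cardsID (D :|: D^-1%g)) defH (setIidPr _); last first.
  by rewrite subUset sDG -(invGid G) invSg.
by rewrite cardsU disj cards0 subn0 card_invg kE addnn mul2n.
Qed.

Lemma rel_skew_card_gt1 : (1 < #|H|)%N.
Proof. by case: ds => _ _ H1 _ _; rewrite cardG_gt1. Qed.

(** The count and the partition of [G] give [v - 1 | h ^ 2 - 1].  The cofactor
    is [1] modulo [h], because [h | v]; if it were not [1] it would exceed [h],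
    forcing [v <= h], that is [D] empty. *)
Lemma rel_skew_card : #|G| = (#|H| ^ 2)%N.
Proof.
have vE := rel_skew_card_sum; have h1 := rel_skew_card_gt1.
case: ds => dsD sHG _ _ _; have := difference_set_count dsD.
case: dsD => D0 _ _ kE _ count.
have k0 : (0 < k)%N by rewrite -kE card_gt0.
have /dvdnP[m mE] := cardSg sHG.
move: vE h1 count mE; move: #|G| #|H| => n h vE h1 count mE.
have [w wE] : exists w, n = w.+1 by exists n.-1; lia.
rewrite {}wE /= in vE count mE *.
(* The count, multiplied by four, with [2 * k] replaced by [w + 1 - h]. *)
have key : (h * h + w * w = 1 + w * (2 * h + 4 * lam))%N.
  have [h' hE] : exists h', h = h'.+1 by exists h.-1; lia.
  have -> : w = (2 * k + h')%N by lia.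
  have : (k * k = k + lam * (2 * k + h'))%N.
    by rewrite count; congr (_ + _ * _)%N; lia.
  by rewrite hE; lia.
have [c cE] : exists c, (2 * h + 4 * lam = w + c)%N.
  exists (2 * h + 4 * lam - w)%N; rewrite subnKC // leqNgt; apply/negP => lt_w.
  have := leq_mul (leqnn w) lt_w; have := leq_mul h1 h1; lia.
(* With [w = v - 1], this is the divisibility of [h ^ 2 - 1] by [v - 1]. *)
have hcE : (h * h = w * c + 1)%N by move: key; rewrite cE; lia.
have c0 : (0 < c)%N by case: c hcE {cE} => // hcE; have := leq_mul h1 h1; lia.
(* Modulo [h] this says that the cofactor [c] is [1]. *)
have hhc : (h * h + c.-1 = h * (m * c))%N.
  by rewrite (_ : h * (m * c) = w.+1 * c)%N ?mE; lia.
have hcm : (h <= m * c)%N by rewrite -(@leq_pmul2l h) -?hhc; lia.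
have [t tE] : exists t, (m * c = h + t)%N by exists (m * c - h)%N; rewrite subnKC.
have ctE : (c = 1 + h * t)%N by move: hhc; rewrite tE; lia.
case: t {tE} ctE => [|t] ctE; first by rewrite -mulnn hcE ctE; lia.
have : (w * h < h * h)%N by rewrite hcE ctE; lia.
by rewrite ltn_mul2r; lia.
Qed.

(** The order [k - lam] of the difference set is a quarter of [h ^ 2]; the
    count gives this after multiplication by [w = h ^ 2 - 1]. *)
Lemma rel_skew_order : (4 * k = 4 * lam + #|H| ^ 2)%N.
Proof.
have vE := rel_skew_card_sum; have h1 := rel_skew_card_gt1.
case: ds => dsD _ _ _ _; have count := difference_set_count dsD.
rewrite rel_skew_card in vE count; rewrite -mulnn in vE count *.
move: h1 vE count; case: #|H| => // h h1 vE count.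
have [w wE] : exists w, (h.+1 * h.+1 = w.+1)%N by exists (h * h + h * 2)%N; lia.
rewrite wE /= in vE count *.
have w0 : (0 < w)%N by lia.
have kkE : (2 * k * (2 * k) = (h * h + h) * (h * h + h))%N by congr (_ * _)%N; lia.
have wwE : (w * w = (h * h + h * 2) * (h * h + h * 2))%N by congr (_ * _)%N; lia.
have kwE : (2 * k * w = (h * h + h) * (h * h + h * 2))%N by congr (_ * _)%N; lia.
by apply/eqP; rewrite -(eqn_pmul2r w0); apply/eqP; lia.
Qed.

End RelativeSkew.

(** * Group sums in the regular representation *)

Section GroupSums.

Variables (F : fieldType) (gT : finGroupType) (G : {group gT}).
Implicit Types A : {set gT}.

Lemma gset_mxE A (i j : 'I_#|G|) : A \subset G ->
  gset_mx F G A i j = ((enum_val i)^-1 * enum_val j \in A)%g%:R.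
Proof.
move=> sAG; rewrite /gset_mx summxE.
have iG : enum_val i \in G := enum_valP i.
have jG : enum_val j \in G := enum_valP j.
have entry x : x \in A ->
    regular_repr F G x i j = (x == (enum_val i)^-1 * enum_val j)%g%:R.
  move=> /(subsetP sAG) xG; rewrite !mxE /= eq_sym -(inj_eq enum_val_inj).
  by rewrite gring_indexK ?groupM // -[in RHS](inj_eq (mulgI (enum_val i))) mulKVg.
rewrite (eq_bigr _ entry); have [cA|cA] := boolP (_ \in A).
  by rewrite (bigD1 _ cA) /= eqxx big1 ?addr0 // => x /andP[_ /negPf->].
by rewrite big1 // => x xA; case: eqP cA => // <-; rewrite xA.
Qed.

Lemma tr_gset_mx A : A \subset G -> (gset_mx F G A)^T = gset_mx F G A^-1%g.
Proof.
move=> sAG; apply/matrixP=> i j; rewrite mxE !gset_mxE //.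
  by rewrite inE invMg invgK.
by rewrite -(invGid G) invSg.
Qed.

Lemma gset_mx_full : gset_mx F G G = const_mx 1.
Proof.
by apply/matrixP=> i j; rewrite gset_mxE // mxE groupM ?groupV ?enum_valP.
Qed.

(** Right multiplication by the sum of a subgroup [K] absorbs each element of
    [K].  For [K = G] this evaluates products with the all-ones matrix, and for
    [A = K] it makes the sum of [K] idempotent up to the factor [#|K|]. *)
Lemma gset_mx_mul_group A (K : {group gT}) : A \subset K -> K \subset G ->
  gset_mx F G A *m gset_mx F G K = #|A|%:R *: gset_mx F G K.
Proof.
move=> sAK sKG; rewrite {1}/gset_mx mulmx_suml.
rewrite (eq_bigr (fun=> gset_mx F G K)); first by rewrite sumr_const scaler_nat.
move=> x /(subsetP sAK) xK; rewrite /gset_mx mulmx_sumr.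
rewrite [RHS](reindex_inj (mulgI x)); apply: eq_big => [y|y yK].
  by rewrite groupMl.
by rewrite repr_mxM ?(subsetP sKG).
Qed.

Lemma difference_set_mx (v k lam : nat) (D : {set gT}) :
    difference_set G v k lam D ->
  gset_mx F G D *m (gset_mx F G D)^T
    = (k%:R - lam%:R)%:M + lam%:R *: const_mx 1.
Proof.
move=> dsD; have := difference_set_sum dsD (regular_repr F G).
case: dsD => _ sDG _ _ _ sumE; rewrite tr_gset_mx // -gset_mx_full.
have -> : gset_mx F G D *m gset_mx F G D^-1%g =
    \sum_(x in D) \sum_(y in D) regular_repr F G (x * y^-1)%g.
  rewrite /gset_mx mulmx_suml; apply: eq_bigr => x xD.
  rewrite mulmx_sumr (reindex_inj invg_inj) /=.
  apply: eq_big => [y|y yD]; first by rewrite inE invgK.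
  rewrite inE invgK in yD.
  by rewrite repr_mxM ?groupV ?(subsetP sDG).
rewrite sumE repr_mx1 /gset_mx [in RHS](bigD1 1%g) //= repr_mx1 -!scaler_nat.
by rewrite scalerDr addrA -[(_ - _)%:M]scalemx1 -scalerDl subrK.
Qed.

End GroupSums.

(** * Matrices with a prescribed skew part *)

(** Since [M] is normal, [K] commutes with [M] and [M^T].  So [N = (M + h) K]
    satisfies [N N^T = h K (M M^T + h (M + M^T) + h ^ 2)], which is
    [h K (2 h ^ 2 - 2 h K) = 0].  A real matrix with [N N^T = 0] vanishes, its
    rows having zero sums of squares. *)
Lemma skew_mul_proj (F : numFieldType) (n : nat) (M K : 'M[F]_n) (h : F) :
    (forall i j, M i j \is Num.real) -> (forall i j, K i j \is Num.real) ->
    h \is Num.real -> h != 0 ->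
    M *m M^T = (h ^+ 2)%:M -> M + M^T = - 2 *: K -> K *m K = h *: K ->
  M *m K = - h *: K.
Proof.
move=> Mreal Kreal hreal h0 MMT skew KK.
have h20 : h ^+ 2 != 0 by rewrite expf_neq0.
have MTM : M^T *m M = (h ^+ 2)%:M.
  have: (h ^- 2 *: M) *m M^T = 1%:M.
    by rewrite -scalemxAl MMT scale_scalar_mx mulVf.
  move/mulmx1C; rewrite -scalemxAr => /(congr1 (fun X => h ^+ 2 *: X)).
  by rewrite scalerA mulfV // scale1r scalemx1.
have two0 : (- 2 : F) != 0 by rewrite oppr_eq0 pnatr_eq0.
have KT : K^T = K.
  apply: (scalerI two0); rewrite -linearZ /= -skew linearD /= trmxK.
  exact: addrC.
have KM : K *m M = M *m K.
  apply: (scalerI two0); rewrite scalemxAl scalemxAr -skew mulmxDl mulmxDr.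
  by rewrite MTM MMT.
have KMT : K *m M^T = - (2 * h) *: K - M *m K.
  have -> : M^T = - 2 *: K - M by rewrite -skew addrC addKr.
  by rewrite mulmxBr -scalemxAr KK KM scalerA mulNr.
pose N := M *m K + h *: K.
have NT : N^T = K *m M^T + h *: K by rewrite /N linearD linearZ /= trmx_mul KT.
have NNT : N *m N^T = 0.
  rewrite NT /N mulmxDl !mulmxDr -!scalemxAl -!scalemxAr.
  have -> : M *m K *m (K *m M^T) = h ^+ 3 *: K.
    rewrite mulmxA -(mulmxA M) KK -scalemxAr -scalemxAl -KM -mulmxA MMT.
    by rewrite mul_mx_scalar scalerA -exprS.
  rewrite -(mulmxA M) KK mulmxA KK -scalemxAl -scalemxAr KMT.
  move: (M *m K) => MK; apply/matrixP=> i j; rewrite !mxE; ring.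
have Nreal i j : N i j \is Num.real.
  by rewrite !mxE realD ?realM // rpred_sum // => l _; rewrite realM.
apply/eqP; rewrite scaleNr -addr_eq0 -/N; apply/eqP/matrixP=> i j.
have := congr1 (fun X : 'M_n => X i i) NNT; rewrite mxE [RHS]mxE.
rewrite (eq_bigr (fun l => N i l ^+ 2)); last first.
  by move=> l _; rewrite [N^T _ _]mxE expr2.
move=> sum0; rewrite [RHS]mxE; apply/eqP; rewrite -sqrf_eq0; apply/eqP.
apply: (psumr_eq0P _ sum0) => // l _.
by rewrite -realEsqr.
Qed.

(** * Minimal polynomials *)

(** A minimality criterion without factorisation: the alternative, listing the
    divisors of [q], would depend on whether [-1] is a square in [F]. *)
Lemma mxminpoly_eq (F : fieldType) (n : nat) (A : 'M[F]_n.+1) (q : {poly F}) :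
    q \is monic -> horner_mx A q = 0 ->
    (forall p : {poly F}, (size p < size q)%N -> horner_mx A p = 0 -> p = 0) ->
  mxminpoly A = q.
Proof.
move=> monq qA0 minq; have dvd := mxminpoly_min qA0.
apply/eqP; rewrite -eqp_monic ?mxminpoly_monic // -dvdp_size_eqp //.
rewrite eqn_leq dvdp_leq ?monic_neq0 //= leqNgt; apply/negP => lt_q.
have := mxminpoly_monic A; rewrite (minq _ lt_q (mx_root_minpoly A)).
by move/monic_neq0; rewrite eqxx.
Qed.

Lemma horner_mx_quadratic (F : fieldType) (n : nat) (A : 'M[F]_n.+1)
    (p : {poly F}) :
  (size p <= 3)%N ->
  horner_mx A p = p`_0 *: 1%:M + p`_1 *: A + p`_2 *: (A *m A).
Proof.
move=> szp; have pE : p = (p`_0)%:P + p`_1 *: 'X + p`_2 *: 'X^2.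
  apply/polyP=> i; rewrite !coefD coefC !coefZ coefX coefXn.
  case: i => [|[|[|i]]] /=; rewrite ?mulr0 ?mulr1 ?addr0 ?add0r //.
  by rewrite nth_default // (leq_trans szp).
rewrite [in LHS]pE !rmorphD /= !linearZ /= rmorphXn /=.
by rewrite horner_mx_C horner_mx_X expr2 scalemx1.
Qed.

(** [M ^ 2] lies in the span of [K] and the identity, so a quadratic relation
    for [M] is a linear relation between [1], [M] and [K].  Row [i0] refutes it:
    column [d] sees only [M], then column [s] isolates [K], then the diagonal
    the identity.  The cast gives the matrix a successor size, which
    [mxminpoly] requires. *)
Lemma skew_minpoly (F : numFieldType) (n m : nat) (e : n = m.+1)
    (M K : 'M[F]_n) (h : F) (i0 d s : 'I_n) :
    M *m K = - h *: K -> M *m M = (2 * h) *: K - (h ^+ 2)%:M -> h != 0 ->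
    i0 != d -> M i0 d = 1 -> K i0 d = 0 ->
    i0 != s -> M i0 s = -1 -> K i0 s = 1 ->
  mxminpoly (castmx (e, e) M) = ('X + h%:P) * ('X^2 + (h ^+ 2)%:P).
Proof.
subst n => MK MM h0 i0d Md Kd i0s Ms Ks.
rewrite castmx_id.
have szq : size (('X + h%:P) * ('X^2 + (h ^+ 2)%:P)) = 4.
  by rewrite size_mul -?size_poly_eq0 ?size_XaddC ?size_XnaddC.
apply: mxminpoly_eq.
- by rewrite monicMl ?monicXaddC // monicE lead_coefXnaddC.
- rewrite rmorphM !rmorphD rmorphXn /= !horner_mx_C horner_mx_X.
  rewrite expr2 -mulmxE MM subrK mulmxDl -scalemxAr MK mul_scalar_mx.
  by rewrite !scalerA -scalerDl mulrN mulrC addNr scale0r.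
move=> p; rewrite szq ltnS => szp; rewrite horner_mx_quadratic // MM => pM.
have entry j : p`_0 * (i0 == j)%:R + p`_1 * M i0 j
    + p`_2 * (2 * h * K i0 j - h ^+ 2 * (i0 == j)%:R) = 0.
  have := congr1 (fun X : 'M_m.+1 => X i0 j) pM.
  by rewrite !mxE -[h ^+ 2 *+ _]mulr_natr.
have p1 : p`_1 = 0.
  by have := entry d; rewrite (negPf i0d) Md Kd !mulr0 subr0 mulr0 mulr1 addr0 add0r.
have p2 : p`_2 = 0.
  have := entry s; rewrite (negPf i0s) p1 Ks mul0r !mulr0 !add0r subr0 mulr1.
  by move/eqP; rewrite !mulf_eq0 pnatr_eq0 (negPf h0) !orbF => /eqP.
have p0 : p`_0 = 0.
  by have := entry i0; rewrite p1 p2 eqxx !mul0r !addr0 mulr1.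
apply/polyP=> i; rewrite coef0.
case: i => [|[|[|i]]] //; exact: nth_default (leq_trans szp _).
Qed.

(** * Relative skew Hadamard difference sets *)

Section RelativeSkewMatrix.

Variables (F : numFieldType) (gT : finGroupType) (G : {group gT}).
Variables (v k lam : nat) (D : {set gT}) (H : {group gT}).
Hypothesis ds : rel_skew_hadamard_ds_group G v k lam D H.

Let M : 'M[F]_#|G| := hadamard_of F G D.
Let K : 'M[F]_#|G| := gset_mx F G H.

Lemma hadamard_ofE i j :
  M i j = 2 * ((enum_val i)^-1 * enum_val j \in D)%g%:R - 1.
Proof.
by case: ds => -[_ sDG _ _ _] _ _ _ _; rewrite !mxE gset_mxE.
Qed.

Lemma hadamard_of_sign i j : M i j = 1 \/ M i j = -1.
Proof.
by rewrite hadamard_ofE; case: (_ \in _); [left|right]; rewrite /=; ring.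
Qed.

(** Entrywise this is the partition: each [g] of [G] lies in exactly one of
    [D], [D^-1] and [H]. *)
Lemma hadamard_of_skew : M + M^T = - 2 *: K.
Proof.
case: ds => -[_ sDG _ _ _] sHG _ _ _; apply/matrixP=> i j.
rewrite mxE [M^T i j]mxE !hadamard_ofE mxE gset_mxE //.
have gG : ((enum_val i)^-1 * enum_val j)%g \in G.
  by rewrite groupM ?groupV ?enum_valP.
have := rel_skew_partition ds gG; rewrite invMg invgK.
by do 3![case: (_ \in _)] => //= _; ring.
Qed.

(** The coefficient of [J] in [(2 D - J) (2 D - J)^T] is [4 lam - 4 k + v],
    zero as [v = h ^ 2]; that of the identity is [4 (k - lam) = h ^ 2]. *)
Lemma rel_skew_hadamard : M *m M^T = (#|H|%:R ^+ 2)%:M.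
Proof.
have vh := rel_skew_card ds.
case: (ds) => dsD _ _ _ _; case: (dsD) => _ sDG _ kE _.
have orderE := rel_skew_order ds.
have orderF : #|H|%:R ^+ 2 = 4 * k%:R - 4 * lam%:R :> F.
  by rewrite -natrX -!natrM orderE natrD addrC addKr.
have vF : #|G|%:R = #|H|%:R ^+ 2 :> F by rewrite vh natrX.
pose J : 'M[F]_#|G| := const_mx 1.
have JE : gset_mx F G G = J by exact: gset_mx_full.
have JT : J^T = J by exact: trmx_const.
have DJ : gset_mx F G D *m J = k%:R *: J by rewrite -JE gset_mx_mul_group // kE.
have JJ : J *m J = #|G|%:R *: J by rewrite -JE gset_mx_mul_group.
have JD : J *m (gset_mx F G D)^T = k%:R *: J.
  by apply: trmx_inj; rewrite trmx_mul trmxK linearZ /= JT DJ.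
rewrite /M /hadamard_of -/J linearB linearZ /= JT.
rewrite mulmxBl !mulmxBr -!scalemxAl -!scalemxAr (difference_set_mx F dsD) -/J.
rewrite DJ JD JJ vF orderF; apply/matrixP=> i j; rewrite !mxE.
case: (i == j); rewrite ?mulr1n ?mulr0n; ring.
Qed.

Lemma hadamard_of_minpoly :
  group_minpoly M = ('X + #|H|%:R%:P) * ('X^2 + (#|H|%:R ^+ 2)%:P).
Proof.
have h0 : #|H|%:R != 0 :> F by rewrite pnatr_eq0 -lt0n cardG_gt0.
have MMT := rel_skew_hadamard; have skew := hadamard_of_skew.
case: (ds) => -[D0 sDG _ _ _] sHG H1 _ _.
have Mreal i j : M i j \is Num.real.
  by case: (hadamard_of_sign i j) => ->; rewrite ?realN real1.
have Kreal i j : K i j \is Num.real by rewrite gset_mxE // realn.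
have KK : K *m K = #|H|%:R *: K by rewrite gset_mx_mul_group.
have MK := skew_mul_proj Mreal Kreal (realn F _) h0 MMT skew KK.
have MM : M *m M = (2 * #|H|%:R) *: K - (#|H|%:R ^+ 2)%:M.
  rewrite -[LHS](addrK (M *m M^T)) -mulmxDr skew MMT -scalemxAr MK scalerA.
  by congr (_ *: _ - _); ring.
(* The columns of [d] and [s] separate [M], [K] and the identity. *)
have [d dD] := set0Pn _ D0; have dG := subsetP sDG d dD.
have [s sH s1] : exists2 s, s \in H & s != 1%g by case/trivgPn: H1 => s; exists s.
have sG := subsetP sHG s sH.
have row1 (A : {set gT}) g : A \subset G -> g \in G ->
    gset_mx F G A (gring_index G 1%g) (gring_index G g) = (g \in A)%:R.
  by move=> sAG gG; rewrite gset_mxE // !gring_indexK // invg1 mul1g.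
have col1 g : g \in G -> g != 1%g -> gring_index G 1%g != gring_index G g.
  move=> gG; apply: contraNneq => /(congr1 enum_val).
  by rewrite !gring_indexK // => ->.
have part := rel_skew_partition ds.
have d1 : d != 1%g.
  apply/eqP=> dE; have dV : d^-1%g = d by rewrite dE invg1.
  by have := part d dG; rewrite dV dD.
have dH : d \in H = false.
  by move: (part d dG); rewrite dD; case: (d \in H); rewrite // addnS.
have sD : s \in D = false.
  by move: (part s sG); rewrite sH; case: (s \in D); rewrite // addnS.
have rowM g : g \in G ->
    M (gring_index G 1%g) (gring_index G g) = 2 * (g \in D)%:R - 1.
  by move=> gG; rewrite !mxE row1.
apply: (skew_minpoly _ MK MM h0 (col1 d dG d1) _ _ (col1 s sG s1)).
- by rewrite rowM // dD /=; ring.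
- by rewrite row1 // dH.
- by rewrite rowM // sD /=; ring.
- by rewrite row1 // sH.
Qed.

End RelativeSkewMatrix.

Theorem theorem1p7 (F : numFieldType) (gT : finGroupType) (G : {group gT})
    (v k lam : nat) (D : {set gT}) (H : {group gT}) :
  rel_skew_hadamard_ds_group G v k lam D H ->
  let h := #|H| in
  [/\ #|G| = (h ^ 2)%N,
      hadamard_mx (hadamard_of F G D) &
      group_minpoly (hadamard_of F G D)
        = ('X + h%:R%:P) * ('X^2 + ((h ^ 2)%N%:R)%:P)].
Proof.
move=> ds h; have vh := rel_skew_card ds; split=> //.
  split; first exact: hadamard_of_sign ds.
  by rewrite (rel_skew_hadamard F ds) vh natrX.
by rewrite natrX; apply: hadamard_of_minpoly ds.
Qed.
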